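(* Let $H$, $J$, $A$ and the Dirac operator $D=D_0+D_1+D_R$ be as in the context, and suppose $\delta_{ij}=0$ for all $(i,j)\in\{(1,2),(1,3),(1,4),(2,1),(2,2),(2,3),(2,4)\}$. Then the Hodge property $\mathcal{C}\ell_D(A)'=\mathcal{C}\ell_D(A)^\circ$ holds if and only if both of the following hold: (i) the matrices $\alpha=\begin{bmatrix}\alpha_{13}&\alpha_{14}\\ \alpha_{23}&\alpha_{24}\end{bmatrix}$ and $\beta=\begin{bmatrix}\beta_{13}&\beta_{14}\\ \beta_{23}&\beta_{24}\end{bmatrix}$ have no zero rows; (ii) there are no $\phi,\psi\in\mathbb{R}$ such that $\alpha=\begin{bmatrix}e^{i\phi}&0\\0&e^{i\psi}\end{bmatrix}\beta$.
   Context: Let $H=M_4(\mathbb{C})\oplus M_4(\mathbb{C})$, with elements written as pairs $(v,w)$ and inner product $\langle (v,w),(v',w')\rangle=\mathrm{Tr}(v^*v')+\mathrm{Tr}(w^*w')$. Let $J$ be the antilinear isometry $J(v,w)=(w^*,v^* )$. Identify $\mathrm{End}_{\mathbb{C}}(H)$ with $M_4(\mathbb{C})\otimes M_2(\mathbb{C})\otimes M_4(\mathbb{C})$ via $\big(x\otimes\begin{bmatrix}a&b\\c&d\end{bmatrix}\otimes y\big)(v,w)=\big(x(av+bw)y^t,\ x(cv+dw)y^t\big)$. Here $e_{ij}$ denotes the matrix unit with $1$ in position $(i,j)$ (size clear from context) and $1$ the identity matrix. Let $A\cong\mathbb{C}\oplus\mathbb{H}\oplus M_3(\mathbb{C})$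 be the real $*$-algebra of operators $\mathrm{diag}(\lambda,\bar\lambda,q)\otimes e_{11}\otimes 1+\mathrm{diag}(\lambda,m)\otimes e_{22}\otimes 1$, where $\lambda\in\mathbb{C}$, $q$ is a quaternion viewed as a $2\times 2$ complex matrix $\begin{bmatrix}z&w\\-\bar w&\bar z\end{bmatrix}$, $m\in M_3(\mathbb{C})$, and $\mathrm{diag}$ denotes block-diagonal $4\times4$ matrices. Fix complex parameters $\alpha_{ij},\beta_{ij}$ ($i\in\{1,2\}$, $j\in\{3,4\}$), $\delta_{12},\delta_{13},\delta_{14},\delta_{21},\delta_{22},\delta_{23},\delta_{24}$ and $\Upsilon_R$. Put $\alpha=\begin{bmatrix}\alpha_{13}&\alpha_{14}\\ \alpha_{23}&\alpha_{24}\end{bmatrix}$, $\beta=\begin{bmatrix}\beta_{13}&\beta_{14}\\ \beta_{23}&\beta_{24}\end{bmatrix}$, $X_\alpha=\begin{bmatrix}0&\alpha\\ \alpha^*&0\end{bmatrix}\in M_4(\mathbb{C})$ (in $2\times2$ blocks), $X_\beta$ likewise, and $Y\in M_4(\mathbb{C})$ the matrix with first row $(0,\delta_{12},\delta_{13},\delta_{14})$, second row $(\delta_{21},\delta_{22},\delta_{23},\delta_{24})$ and zero third and fourth rows. Define $D_0=X_\alpha\otimes e_{11}\otimes e_{11}+X_\beta\otimes e_{11}\otimes(1-e_{11})+Y\otimes e_{12}\otimes e_{11}+Y^*\otimes e_{21}\otimes e_{11}$, $D_1=JD_0J^{-1}$, $D_R=e_{11}\otimes(\Upsilon_R e_{21}+\overline{\Upsilon}_R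 e_{12})\otimes e_{11}$, and $D=D_0+D_1+D_R$. For $\xi\in\mathrm{End}_{\mathbb{C}}(H)$ set $\xi^\circ=J\xi^*J^{-1}$, and for a subset $S$ set $S^\circ=\{\xi^\circ:\xi\in S\}$ and $S'=\{\xi\in\mathrm{End}_{\mathbb{C}}(H): [\xi,\eta]=0\ \forall\eta\in S\}$. $\mathcal{C}\ell_D(A)$ is the complex $*$-subalgebra of $\mathrm{End}_{\mathbb{C}}(H)$ generated by $A$ and the operators $a[D,b]$, $a,b\in A$. The Hodge property means $\mathcal{C}\ell_D(A)'=\mathcal{C}\ell_D(A)^\circ$. *)

(* Defs.v *)
From mathcomp Require Import all_boot all_algebra.
From mathcomp Require Import complex.
From mathcomp Require Import reals trigo.

Set Implicit Arguments.
Unset Strict Implicit.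
Unset Printing Implicit Defensive.

Import GRing.Theory.
Local Open Scope ring_scope.

Section Dirac.
Variable R : realType.
Local Notation C := R[i].

Definition adjmx (n m : nat) (A : 'M[C]_(n, m)) : 'M[C]_(m, n) :=
  map_mx (@conjc R) A^T.

Definition H : Type := ('M[C]_4 * 'M[C]_4)%type.

Definition Op : Type := H -> H.

Definition linop (xi : Op) : Prop :=
  forall (c : C) (x y : H), xi (c *: x + y) = c *: xi x + xi y.

Definition ip (x y : H) : C := \tr (adjmx x.1 *m y.1) + \tr (adjmx x.2 *m y.2).

Definition J (x : H) : H := (adjmx x.2, adjmx x.1).
(** J^{-1}: solving J(a,b) = (v,w) gives (a,b) = (w^*, v^* ) *)
Definition Jinv (x : H) : H := (adjmx x.2, adjmx x.1).

Definition hbasis (k : 'I_2 * 'I_4 * 'I_4) : H :=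
  let: (c, i, j) := k in
  if c == ord0 then (delta_mx i j, 0) else (0, delta_mx i j).

(** Hilbert-space adjoint of a linear operator: xi^* x = sum_k <xi e_k, x> e_k,
    which satisfies <xi^* x, y> = <x, xi y>. *)
Definition adjop (xi : Op) : Op :=
  fun x => \sum_(k : 'I_2 * 'I_4 * 'I_4) ip (xi (hbasis k)) x *: hbasis k.

Definition opp_op (xi : Op) : Op := fun x => J (adjop xi (Jinv x)).

Definition E2 (i j : 'I_2) : 'M[C]_2 := delta_mx i j.
Definition E4 (i j : 'I_4) : 'M[C]_4 := delta_mx i j.
Definition i0 : 'I_2 := ord0.
Definition i1 : 'I_2 := ord_max.
Definition k0 : 'I_4 := ord0.

(** the identification M_4 (x) M_2 (x) M_4 = End_C(H):
    (x (x) [a b; c d] (x) y)(v,w) = (x(av+bw)y^t, x(cv+dw)y^t) *)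
Definition tens (x : 'M[C]_4) (M : 'M[C]_2) (y : 'M[C]_4) : Op :=
  fun h => (x *m (M i0 i0 *: h.1 + M i0 i1 *: h.2) *m y^T,
            x *m (M i1 i0 *: h.1 + M i1 i1 *: h.2) *m y^T).

Definition mx2 (a b c d : C) : 'M[C]_2 :=
  \matrix_(i < 2, j < 2)
    if (i : nat) == 0%N then (if (j : nat) == 0%N then a else b)
    else (if (j : nat) == 0%N then c else d).

Definition diagLq (lam z w : C) : 'M[C]_4 :=
  block_mx (mx2 lam 0 0 (conjc lam)) 0 0 (mx2 z w (- conjc w) (conjc z)).

Definition diagLm (lam : C) (m : 'M[C]_3) : 'M[C]_4 :=
  block_mx (lam%:M : 'M[C]_1) 0 0 m.

(** generic element of A = C (+) H (+) M_3(C) *)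
Definition Aop (lam z w : C) (m : 'M[C]_3) : Op :=
  fun h => tens (diagLq lam z w) (E2 i0 i0) 1%:M h
         + tens (diagLm lam m) (E2 i1 i1) 1%:M h.

Definition inA (xi : Op) : Prop :=
  exists (lam z w : C) (m : 'M[C]_3), forall h, xi h = Aop lam z w m h.

Definition Xmx (a : 'M[C]_2) : 'M[C]_4 := block_mx 0 a (adjmx a) 0.

Definition Ymx (d12 d13 d14 d21 d22 d23 d24 : C) : 'M[C]_4 :=
  \matrix_(i < 4, j < 4)
    if (i : nat) == 0%N then [:: 0; d12; d13; d14]`_j
    else if (i : nat) == 1%N then [:: d21; d22; d23; d24]`_j
    else 0.

Definition D0 (al be Y : 'M[C]_4) : Op := fun h =>
    tens al (E2 i0 i0) (E4 k0 k0) h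
  + tens be (E2 i0 i0) (1%:M - E4 k0 k0) h
  + tens Y (E2 i0 i1) (E4 k0 k0) h
  + tens (adjmx Y) (E2 i1 i0) (E4 k0 k0) h.

Definition D1 (al be Y : 'M[C]_4) : Op := fun h => J (D0 al be Y (Jinv h)).

Definition DR (ups : C) : Op :=
  tens (E4 k0 k0) (ups *: E2 i1 i0 + conjc ups *: E2 i0 i1) (E4 k0 k0).

Definition Dirac (alpha beta : 'M[C]_2) (Y : 'M[C]_4) (ups : C) : Op :=
  let X1 := Xmx alpha in let X2 := Xmx beta in
  fun h => D0 X1 X2 Y h + D1 X1 X2 Y h + DR ups h.

Inductive Cl (D : Op) : Op -> Prop :=
| Cl_A xi : inA xi -> Cl D xi
| Cl_comm a b : inA a -> inA b -> Cl D (fun h => a (D (b h) - b (D h)))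
| Cl_add f g : Cl D f -> Cl D g -> Cl D (fun h => f h + g h)
| Cl_scale (c : C) f : Cl D f -> Cl D (fun h => c *: f h)
| Cl_mul f g : Cl D f -> Cl D g -> Cl D (fun h => f (g h))
| Cl_adj f : Cl D f -> Cl D (adjop f).

Definition Hodge (D : Op) : Prop :=
  forall xi : Op,
    (linop xi /\ forall eta, Cl D eta -> forall h, xi (eta h) = eta (xi h))
    <-> (exists eta, Cl D eta /\ forall h, xi h = opp_op eta h).

Definition expi (phi : R) : C := (cos phi +i* sin phi)%C.

End Dirac.

(* Main.v *)
(* With [P0 = e11] and [P1 = 1 - e11], every element of the Clifford algebra acts
   by [(v, w) |-> (X v P0 + Y v P1, N w)] with [N] commuting with [P0], and all
   such operators form an algebra whose commutant is exactly its opposite.  So the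
   Hodge property says that the Clifford algebra is this whole algebra.  The
   possible pairs [(X, Y)] form a *-algebra containing the diagonal quaternions
   and the one-forms [(e_ii alpha q, e_ii beta q)]; it is all of [M4 x M4] as soon
   as [X] and [Y] can be separated, that is, unless a row vanishes or [alpha] and
   [beta] agree up to row phases.  In those exceptional cases a projection
   [e_ii (x) e11 (x) P], respectively a unitary intertwiner between the two copies
   of [C^4], is an extra element of the commutant. *)
From HB Require Import structures.
Require Import Defs.
From mathcomp Require Import all_boot all_algebra.
From mathcomp Require Import complex.
From mathcomp Require Import reals trigo.
From mathcomp Require Import boolp ring.
Local Open Scope ring_scope.
Set Implicit Arguments.
Unset Strict Implicit.
Unset Printing Implicit Defensive.
Import GRing.Theory Num.Theory.

(** * Conjugate transposes and Hilbert-space adjoints *)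

Section Adjoint.
Variable R : realType.
Local Notation C := R[i].

Lemma adjmxD n m (A B : 'M[C]_(n, m)) : adjmx (A + B) = adjmx A + adjmx B.
Proof. by rewrite /adjmx linearD map_mxD. Qed.

Lemma adjmx0 n m : adjmx (0 : 'M[C]_(n, m)) = 0.
Proof. by rewrite /adjmx trmx0 map_mx0. Qed.

Lemma adjmxZ n m c (A : 'M[C]_(n, m)) : adjmx (c *: A) = conjc c *: adjmx A.
Proof. by rewrite /adjmx linearZ map_mxZ. Qed.

Lemma adjmxM n m p (A : 'M[C]_(n, m)) (B : 'M[C]_(m, p)) :
  adjmx (A *m B) = adjmx B *m adjmx A.
Proof. by rewrite /adjmx trmx_mul map_mxM. Qed.

Lemma adjmxK n m (A : 'M[C]_(n, m)) : adjmx (adjmx A) = A.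
Proof. by apply/matrixP => i j; rewrite !mxE conjcK. Qed.

Lemma adjmx1 n : adjmx (1%:M : 'M[C]_n) = 1%:M.
Proof. by rewrite /adjmx trmx1 map_mx1. Qed.

Lemma adjmx_delta n m i j : adjmx (delta_mx i j : 'M[C]_(n, m)) = delta_mx j i.
Proof. by rewrite /adjmx trmx_delta map_delta_mx. Qed.

Lemma trace_adj_delta n m i j (A : 'M[C]_(n, m)) :
  \tr (adjmx (delta_mx i j) *m A) = A i j.
Proof.
rewrite adjmx_delta /mxtrace (bigD1 j) //= big1 => [|k /negbTE kj].
  rewrite mxE (bigD1 i) //= big1 => [|l /negbTE li]; rewrite !mxE ?eqxx ?li.
    by rewrite mul1r !addr0.
  by rewrite andbF mul0r.
by rewrite mxE big1 // => l _; rewrite mxE kj mul0r.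
Qed.

Lemma ip_hbasis (k : 'I_2 * 'I_4 * 'I_4) (y : H R) :
  ip (hbasis R k) y = if k.1.1 == ord0 then y.1 k.1.2 k.2 else y.2 k.1.2 k.2.
Proof.
case: k => [[c i] j] /=; rewrite /ip /hbasis; case: eqP => _ /=;
by rewrite adjmx0 mul0mx mxtrace0 trace_adj_delta ?addr0 ?add0r.
Qed.

Lemma hbasis_expand (y : H R) : \sum_k ip (hbasis R k) y *: hbasis R k = y.
Proof.
transitivity (\sum_c \sum_i \sum_j ip (hbasis R (c, i, j)) y *: hbasis R (c, i, j)).
  by rewrite !pair_bigA; apply: eq_bigr => [[[c i] j]].
have sum_pair (I : finType) (F : I -> 'M[C]_4 * 'M[C]_4) :
    \sum_i F i = (\sum_i (F i).1, \sum_i (F i).2).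
  by rewrite [LHS]surjective_pairing (raddf_sum fst) (raddf_sum snd).
under eq_bigr do under eq_bigr do (under eq_bigr do rewrite ip_hbasis;
  rewrite sum_pair); rewrite /hbasis.
under eq_bigr do rewrite sum_pair; rewrite big_ord_recl big_ord1 /=.
rewrite [RHS]surjective_pairing [y.1 in RHS]matrix_sum_delta.
rewrite [y.2 in RHS]matrix_sum_delta; congr (_, _) => /=.
  rewrite [X in _ + X]big1 ?addr0 // => i _.
  by rewrite big1 // => j _; rewrite scaler0.
rewrite [X in X + _]big1 ?add0r // => i _.
by rewrite big1 // => j _; rewrite scaler0.
Qed.

(** The sum defining [adjop f] at [y] has coefficients [ip (f e_k) y = ip e_k (g y)], so it is the
    expansion of [g y] in the orthonormal basis. *)
Lemma adjop_eq (f g : Op R) :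
  (forall x y, ip (f x) y = ip x (g y)) -> adjop f = g.
Proof.
move=> fg; apply: funext => y; rewrite -[RHS]hbasis_expand /adjop.
by apply: eq_bigr => k _; rewrite fg.
Qed.

End Adjoint.

(** * Arithmetic of 4 by 4 matrices in 2 by 2 blocks *)

Section Blocks.
Variable R : realType.
Local Notation C := R[i].
Implicit Types (a b c d : 'M[C]_2).

Definition blk a b c d : 'M[C]_4 := block_mx a b c d.

Lemma blkM a b c d a' b' c' d' : blk a b c d *m blk a' b' c' d' =
  blk (a *m a' + b *m c') (a *m b' + b *m d')
      (c *m a' + d *m c') (c *m b' + d *m d').
Proof. exact: (@mulmx_block _ 2 2 2 2 2 2). Qed.

Lemma blkD a b c d a' b' c' d' :
  blk a b c d + blk a' b' c' d' = blk (a + a') (b + b') (c + c') (d + d').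
Proof. exact: (@add_block_mx _ 2 2 2 2). Qed.

Lemma blkZ (x : C) a b c d :
  x *: blk a b c d = blk (x *: a) (x *: b) (x *: c) (x *: d).
Proof. exact: (@scale_block_mx _ 2 2 2 2). Qed.

Lemma blkN a b c d : - blk a b c d = blk (- a) (- b) (- c) (- d).
Proof. exact: (@opp_block_mx _ 2 2 2 2). Qed.

Lemma adjmx_blk a b c d :
  adjmx (blk a b c d) = blk (adjmx a) (adjmx c) (adjmx b) (adjmx d).
Proof.
by rewrite /adjmx /blk -map_block_mx; congr map_mx; apply: (@tr_block_mx _ 2 2 2 2).
Qed.

Lemma blk0 : blk 0 0 0 0 = 0.
Proof. exact: (@block_mx_const _ 2 2 2 2). Qed.

Lemma blkE (X : 'M[C]_4) : exists a b c d, X = blk a b c d.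
Proof.
exists (@ulsubmx _ 2 2 2 2 X), (@ursubmx _ 2 2 2 2 X), (@dlsubmx _ 2 2 2 2 X).
by exists (@drsubmx _ 2 2 2 2 X); rewrite /blk (@submxK _ 2 2 2 2).
Qed.

End Blocks.

(** * The operators [bop X Y N], their opposites and their commutant *)

Section BlockOperators.
Variable R : realType.
Local Notation C := R[i].
Implicit Types (X Y N : 'M[C]_4) (h : H R).

Definition P0 : 'M[C]_4 := locked (E4 R k0 k0).
Definition P1 : 'M[C]_4 := locked (1%:M - P0).

Lemma P0E : P0 = E4 R k0 k0.
Proof. by rewrite /P0 -lock. Qed.

Lemma P1E : P1 = 1%:M - P0.
Proof. by rewrite /P1 -lock. Qed.

Lemma P0P0 : P0 *m P0 = P0.
Proof. by rewrite P0E /E4 mul_delta_mx. Qed.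

Lemma P0P1 : P0 *m P1 = 0.
Proof. by rewrite P1E mulmxBr mulmx1 P0P0 subrr. Qed.

Lemma P1P0 : P1 *m P0 = 0.
Proof. by rewrite P1E mulmxBl mul1mx P0P0 subrr. Qed.

Lemma P1P1 : P1 *m P1 = P1.
Proof. by rewrite {2}P1E mulmxBr mulmx1 P1P0 subr0. Qed.

Lemma P01 : P0 + P1 = 1%:M.
Proof. by rewrite P1E addrC subrK. Qed.

Lemma adjP0 : adjmx P0 = P0.
Proof. by rewrite P0E; apply: adjmx_delta. Qed.

Lemma adjP1 : adjmx P1 = P1.
Proof. by rewrite P1E -scaleN1r adjmxD adjmxZ adjP0 adjmx1 rmorphN1. Qed.

Lemma P1_comm (A : 'M[C]_4) : A *m P0 = P0 *m A -> A *m P1 = P1 *m A.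
Proof. by move=> cA; rewrite P1E mulmxBr mulmxBl cA mulmx1 mul1mx. Qed.

(* [X (x) e11 (x) e11 + Y (x) e11 (x) (1 - e11) + N (x) e22 (x) 1] *)
Definition bop X Y N : Op R :=
  fun h => (X *m h.1 *m P0 + Y *m h.1 *m P1, N *m h.2).

Lemma pair_eq (S T : Type) (a a' : S) (b b' : T) :
  a = a' -> b = b' -> (a, b) = (a', b').
Proof. by move=> -> ->. Qed.

Lemma bop_add X Y N X' Y' N' h :
  bop X Y N h + bop X' Y' N' h = bop (X + X') (Y + Y') (N + N') h.
Proof. by rewrite /bop !mulmxDl; apply: pair_eq; [apply: addrACA|]. Qed.

Lemma bop_scale c X Y N h :
  c *: bop X Y N h = bop (c *: X) (c *: Y) (c *: N) h.
Proof. by rewrite /bop -!scalemxAl -scalerDr. Qed.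

Lemma bop_mul X Y N X' Y' N' h :
  bop X Y N (bop X' Y' N' h) = bop (X *m X') (Y *m Y') (N *m N') h.
Proof.
rewrite /bop /= !(mulmxDr, mulmxDl) !mulmxA; apply: pair_eq; last by [].
rewrite -[X in X + _ + _]mulmxA P0P0 -[X in _ + X + _]mulmxA P1P0.
rewrite -[X in _ + (X + _)]mulmxA P0P1 -[X in _ + (_ + X)]mulmxA P1P1.
by rewrite !mulmx0 addr0 add0r; reflexivity.
Qed.

Lemma adjop_bop X Y N : adjop (bop X Y N) = bop (adjmx X) (adjmx Y) (adjmx N).
Proof.
apply: adjop_eq => x y; rewrite /ip /bop /=; congr (_ + _); last first.
  by rewrite adjmxM mulmxA.
rewrite adjmxD !adjmxM adjP0 adjP1 mulmxDl mulmxDr !mxtraceD.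
by rewrite -!mulmxA [X in X + _]mxtrace_mulC [X in _ + X]mxtrace_mulC -!mulmxA.
Qed.

Lemma opp_bop X Y N h :
  opp_op (bop X Y N) h = (h.1 *m N, P0 *m h.2 *m X + P1 *m h.2 *m Y).
Proof.
rewrite /opp_op adjop_bop /J /Jinv /bop /= adjmxD !adjmxM !adjmxK adjP0 adjP1.
by rewrite !mulmxA.
Qed.

Lemma linop_bop_opp X Y N :
  linop (fun h : H R => (h.1 *m N, P0 *m h.2 *m X + P1 *m h.2 *m Y)).
Proof.
move=> c x y /=; rewrite mulmxDl !mulmxDr !mulmxDl -!scalemxAr -!scalemxAl.
apply: pair_eq; first by [].
by rewrite /= scalerDr; apply: addrACA.
Qed.

(** Left and right multiplications commute; what remains is to move [N] past [P0], [P1] on the right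
    and [N'] past them on the left. *)
Lemma bop_opp_comm X Y N X' Y' N' h : N *m P0 = P0 *m N -> N' *m P0 = P0 *m N' ->
  opp_op (bop X Y N) (bop X' Y' N' h) = bop X' Y' N' (opp_op (bop X Y N) h).
Proof.
move=> cN cN'; rewrite !opp_bop /bop /=.
apply: pair_eq.
  by rewrite mulmxDl -!mulmxA cN (P1_comm cN).
by rewrite mulmxDr !mulmxA -cN' -(P1_comm cN').
Qed.

Lemma delta_mulE n m p (i : 'I_n) (j : 'I_m) (A : 'M[C]_(m, p)) a b :
  (delta_mx i j *m A) a b = A j b *+ (a == i).
Proof.
rewrite mxE (bigD1 j) //= big1 => [|k /negbTE kj]; last first.
  by rewrite mxE kj andbF mul0r.
by rewrite mxE eqxx andbT addr0; case: (a == i); rewrite ?mul1r ?mul0r.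
Qed.

Lemma linop_eq_delta (f g : 'M[C]_4 -> 'M[C]_4) :
  (forall c x y, f (c *: x + y) = c *: f x + f y) ->
  (forall c x y, g (c *: x + y) = c *: g x + g y) ->
  (forall i j, f (delta_mx i j) = g (delta_mx i j)) -> f =1 g.
Proof.
move=> lf lg fg A.
pose F : {linear _ -> _} := HB.pack f (GRing.isLinear.Build _ _ _ _ f lf).
pose G : {linear _ -> _} := HB.pack g (GRing.isLinear.Build _ _ _ _ g lg).
rewrite [A]matrix_sum_delta -[f _]/(F _) -[g _]/(G _) !linear_sum.
apply: eq_bigr => i _; rewrite !linear_sum; apply: eq_bigr => j _.
by rewrite !linearZ /= fg.
Qed.

(** The projections onto the two summands force [xi] to be block diagonal. On the first summand,
    commuting with all left multiplications makes it a right multiplication. On the second, only the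
    left multiplications by C + M_3 are available, which leaves one right factor for row 0 and
    another for the remaining rows. *)
Lemma commutant_bop (xi : Op R) : linop xi ->
  (forall X Y N, N *m P0 = P0 *m N ->
     forall h, xi (bop X Y N h) = bop X Y N (xi h)) ->
  exists X Y N, N *m P0 = P0 *m N /\ forall h, xi h = opp_op (bop X Y N) h.
Proof.
move=> lxi cxi.
have bopQ h : bop 1%:M 1%:M 0 h = (h.1, 0).
  by rewrite /bop !mul1mx mul0mx -mulmxDr P01 mulmx1.
have bopQ' h : bop 0 0 1%:M h = (0, h.2).
  by rewrite /bop !mul0mx !mul1mx addr0.
have xi1 v : (xi (v, 0)).2 = 0.
  have := cxi 1%:M 1%:M 0 _ (v, 0); rewrite mulmx0 mul0mx => /(_ erefl).
  by rewrite !bopQ => ->.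
have xi2 w : (xi (0, w)).1 = 0.
  have := cxi 0 0 1%:M _ (0, w); rewrite mulmx1 mul1mx => /(_ erefl).
  by rewrite !bopQ' => ->.
have xiD h : xi h = xi (h.1, 0) + xi (0, h.2).
  have := lxi 1 (h.1, 0) (0, h.2); rewrite !scale1r => <-; congr xi.
  by rewrite [LHS]surjective_pairing; congr (_, _); rewrite /= ?addr0 ?add0r.
pose f v := (xi (v, 0)).1; pose g w := (xi (0, w)).2.
have cf X Y v : f (X *m v *m P0 + Y *m v *m P1) = X *m f v *m P0 + Y *m f v *m P1.
  have := cxi X Y 0 _ (v, 0); rewrite mulmx0 mul0mx => /(_ erefl).
  by rewrite {1}/bop /= mul0mx /f => ->.
have cg N w : N *m P0 = P0 *m N -> g (N *m w) = N *m g w.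
  by move=> /(cxi 0 0 N)/(_ (0, w)); rewrite {1}/bop /= !mul0mx addr0 /g => ->.
have lg c x y : g (c *: x + y) = c *: g x + g y.
  rewrite /g -[c *: (xi _).2]/((c *: xi _).2) -[RHS]/((_ + _).2) -lxi.
  by congr (xi _).2; rewrite [RHS]surjective_pairing /= scaler0 addr0.
have fE v : f v = v *m f 1%:M.
  have := cf v v 1%:M.
  by rewrite !mulmx1 -!mulmxDr P01 !mulmx1.
(* Row [i1] represents all rows other than 0: [X] is read off from the image of row 0 and [Y] from
   that of row [i1]. *)
pose i1 : 'I_4 := lift k0 ord0.
pose X : 'M[C]_4 := \matrix_(j, k) g (delta_mx k0 j) k0 k.
pose Y : 'M[C]_4 := \matrix_(j, k) g (delta_mx i1 j) i1 k.
exists X, Y, (f 1%:M); split.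
  have := cf 1%:M 0 1%:M; rewrite !mul0mx !addr0 !mul1mx => <-; exact: fE.
move=> h; rewrite opp_bop xiD [LHS]surjective_pairing /= xi1 xi2 addr0 add0r.
apply: pair_eq; first exact: fE.
rewrite -/(g _); apply: (@linop_eq_delta g (fun w => P0 *m w *m X + P1 *m w *m Y)).
- exact: lg.
- move=> c x y.
  exact: (congr1 (fun h : H R => h.2) (linop_bop_opp X Y 0 c (0, x) (0, y))).
move=> i j; have [->|i_neq0] := eqVneq i k0.
  have P0d : P0 *m delta_mx k0 j = delta_mx k0 j by rewrite P0E mul_delta_mx.
  rewrite P1E mulmxBl P0d mul1mx subrr mul0mx addr0 -{1}P0d cg //.
  by apply/matrixP => a b; rewrite P0E !delta_mulE mxE.
have P0d k : P0 *m delta_mx i k = 0 :> 'M[C]_4.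
  by rewrite P0E mul_delta_mx_cond eq_sym (negbTE i_neq0).
(* Since [i] and [i1] both differ from 0, [delta_mx i i1] commutes with [P0], and it carries the
   formula from row [i1] to row [i]. *)
rewrite P1E mulmxBl !P0d mul1mx subr0 mul0mx add0r -(mul_delta_mx i1) cg.
  by apply/matrixP => a b; rewrite -mulmxA !delta_mulE mxE.
by rewrite P0d P0E mul_delta_mx_cond.
Qed.

End BlockOperators.

(** * Elements of [A], one-forms, and the shape of Clifford elements *)

Section Clifford.
Variable R : realType.
Local Notation C := R[i].
Local Notation P0 := (P0 R).
Local Notation P1 := (P1 R).
Implicit Types (X Y N : 'M[C]_4) (h : H R).

Lemma blk_delta (k l : 'I_2) : blk (delta_mx k l) 0 0 0 =
  delta_mx (lshift 2 k : 'I_4) (lshift 2 l : 'I_4) :> 'M[C]_4.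
Proof.
apply/matrixP => i j; rewrite /blk !mxE.
by case: (@splitP 2 2 i) => a eqa; rewrite !mxE; case: (@splitP 2 2 j) => b eqb;
   rewrite !mxE // -!val_eqE /= eqa eqb ?(gtn_eqF (ltn_addr _ (ltn_ord _))) ?andbF.
Qed.

Lemma P0_blk : P0 = blk (delta_mx ord0 ord0) 0 0 0.
Proof. by rewrite P0E blk_delta; congr delta_mx; apply/val_inj. Qed.

Lemma P0_block1 : P0 = block_mx (1%:M : 'M_1) 0 0 (0 : 'M_3).
Proof.
rewrite P0E; apply/matrixP => i j; rewrite !mxE.
by case: (@splitP 1 3 i) => a eqa; rewrite !mxE; case: (@splitP 1 3 j) => b eqb;
   rewrite !mxE // -!val_eqE /= eqa eqb ?(ord1 a) ?(ord1 b) ?andbF.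
Qed.

Lemma diagLm_P0 lam (m : 'M[C]_3) : diagLm lam m *m P0 = lam *: P0.
Proof.
rewrite P0_block1 (@mulmx_block _ 1 3 1 3 1 3) (@scale_block_mx _ 1 3 1 3).
by rewrite !mulmx0 !mul0mx !addr0 mulmx1 !scaler0 scalemx1.
Qed.

Lemma P0_diagLm lam (m : 'M[C]_3) : P0 *m diagLm lam m = lam *: P0.
Proof.
rewrite P0_block1 (@mulmx_block _ 1 3 1 3 1 3) (@scale_block_mx _ 1 3 1 3).
by rewrite !mulmx0 !mul0mx !addr0 mul1mx !scaler0 scalemx1.
Qed.

(** In 1 + 3 blocks, commuting with e11 kills the off-diagonal blocks. Thus the matrices [N] allowed
    in [bop] are exactly those by which [A] acts on the second summand. *)
Lemma diagLm_comm N : N *m P0 = P0 *m N -> exists lam m, N = diagLm lam m.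
Proof.
rewrite P0_block1 -[N](@submxK _ 1 3 1 3) !(@mulmx_block _ 1 3 1 3 1 3).
rewrite !(mulmx0, mul0mx, addr0, mulmx1, mul1mx) => /(@eq_block_mx _ 1 3 1 3).
case=> _ <- -> _; exists (@ulsubmx _ 1 3 1 3 N ord0 ord0).
by exists (@drsubmx _ 1 3 1 3 N); rewrite /diagLm -mx11_scalar.
Qed.

Lemma diagLq_P0 lam z w : diagLq lam z w *m P0 = lam *: P0 :> 'M[C]_4.
Proof.
rewrite P0_blk -[diagLq _ _ _]/(blk _ _ _ _) blkM blkZ.
rewrite !mulmx0 !mul0mx !addr0 !scaler0; congr blk.
by apply/matrixP => i j; rewrite !mxE !big_ord_recl big_ord0 !mxE;
  case: i => [[|[]]] //= ?; case: j => [[|[]]] //= ?;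
  rewrite ?(mulr1, mulr0, mul0r, addr0).
Qed.

Lemma P0_diagLq lam z w : P0 *m diagLq lam z w = lam *: P0 :> 'M[C]_4.
Proof.
rewrite P0_blk -[diagLq _ _ _]/(blk _ _ _ _) blkM blkZ.
rewrite !mulmx0 !mul0mx !addr0 !scaler0; congr blk.
by apply/matrixP => i j; rewrite !mxE !big_ord_recl big_ord0 !mxE;
  case: i => [[|[]]] //= ?; case: j => [[|[]]] //= ?;
  rewrite ?(mul1r, mulr1, mulr0, mul0r, addr0).
Qed.

Lemma adjmx_Xmx (a : 'M[C]_2) : adjmx (Xmx a) = Xmx a.
Proof. by rewrite -[Xmx a]/(blk _ _ _ _) adjmx_blk !adjmx0 adjmxK. Qed.

Lemma Ymx0 : Ymx 0 0 0 0 0 0 0 = 0 :> 'M[C]_4.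
Proof.
by apply/matrixP => i j; rewrite !mxE;
  case: i => [[|[|[|[]]]]] //= ?; case: j => [[|[|[|[]]]]].
Qed.

Lemma tensE (x y : 'M[C]_4) (M : 'M[C]_2) a b c d h :
  M i0 i0 = a -> M i0 i1 = b -> M i1 i0 = c -> M i1 i1 = d ->
  tens x M y h = (x *m (a *: h.1 + b *: h.2) *m y^T,
                  x *m (c *: h.1 + d *: h.2) *m y^T).
Proof. by move=> <- <- <- <-. Qed.

Lemma AopE lam z w (m : 'M[C]_3) : Aop lam z w m =
  bop (diagLq lam z w) (diagLq lam z w) (diagLm lam m).
Proof.
apply: funext => h; rewrite /Aop (@tensE _ _ _ 1 0 0 0) ?mxE //.
rewrite (@tensE _ _ _ 0 0 0 1) ?mxE // !scale0r !scale1r !add0r !addr0.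
rewrite trmx1 !mulmx1 !mulmx0 /bop -mulmxDr P01 mulmx1.
by apply: pair_eq; rewrite /= ?addr0 ?add0r.
Qed.

Lemma trmxP0 : P0^T = P0.
Proof. by rewrite P0E trmx_delta. Qed.

Lemma trmxP1 : P1^T = P1.
Proof. by rewrite P1E linearB /= trmx1 trmxP0. Qed.

Lemma D0E X Y h : D0 X Y 0 h = (X *m h.1 *m P0 + Y *m h.1 *m P1, 0).
Proof.
rewrite /D0 (@tensE _ _ _ 1 0 0 0) ?mxE // (@tensE _ _ _ 1 0 0 0) ?mxE //.
rewrite (@tensE _ _ _ 0 1 0 0) ?mxE // (@tensE _ _ _ 0 0 1 0) ?mxE //.
rewrite !scale0r !scale1r !add0r !addr0 adjmx0 !mul0mx !mulmx0 !mul0mx.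
rewrite -P0E -P1E trmxP0 trmxP1.
by apply: pair_eq; rewrite /= ?addr0.
Qed.

Lemma DiracE (alpha beta : 'M[C]_2) ups h :
  Dirac alpha beta 0 ups h =
  (Xmx alpha *m h.1 *m P0 + Xmx beta *m h.1 *m P1
     + conjc ups *: (P0 *m h.2 *m P0),
   P0 *m h.2 *m Xmx alpha + P1 *m h.2 *m Xmx beta
     + ups *: (P0 *m h.1 *m P0)).
Proof.
rewrite /Dirac D0E /D1 D0E /Jinv /J /DR (@tensE _ _ _ 0 (conjc ups) ups 0);
  rewrite ?mxE ?(mulr0, mulr1, addr0, add0r) //.
rewrite !scale0r add0r addr0 -P0E trmxP0 -!scalemxAr -!scalemxAl.
rewrite adjmx0 [(_, _).1]/= adjmxD !adjmxM adjmxK !adjmx_Xmx adjP0 adjP1 !mulmxA.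
by apply: pair_eq; rewrite /= ?addr0 ?add0r.
Qed.

Lemma pair_sub (U V : zmodType) (a c : U) (b d : V) :
  (a, b) - (c, d) = (a - c, b - d).
Proof. by []. Qed.

Lemma addrBDr (V : zmodType) (x y z : V) : (x + z) - (y + z) = x - y.
Proof. by rewrite opprD addrACA subrr addr0. Qed.

Lemma bop_diag X N h : bop X X N h = (X *m h.1, N *m h.2).
Proof. by rewrite /bop -mulmxDr P01 mulmx1. Qed.

(** The part [D1] cancels because [diagLm lam m] commutes with [P0] and [P1]; the part [DR] cancels
    because [diagLq] and [diagLm] both act as the same [lam] on [P0]. Only the commutator of [D0]
    with [q] survives, on the first summand. *)
Lemma Dirac_comm (alpha beta : 'M[C]_2) ups X Y N lam z w m :
  let b := Aop lam z w m in let q := diagLq lam z w in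
  let D := Dirac alpha beta 0 ups in
  (fun h => bop X Y N (D (b h) - b (D h))) =
  bop (X *m (Xmx alpha *m q - q *m Xmx alpha))
      (Y *m (Xmx beta *m q - q *m Xmx beta)) 0.
Proof.
move=> b q D; apply: funext => h.
have -> : D (b h) - b (D h) = bop (Xmx alpha *m q - q *m Xmx alpha)
                                  (Xmx beta *m q - q *m Xmx beta) 0 h.
  set n := diagLm lam m.
  have nP1 : n *m P1 = P1 *m n by apply: P1_comm; rewrite diagLm_P0 P0_diagLm.
  have b1 : P0 *m (n *m h.2) *m P0 = q *m (P0 *m h.2 *m P0).
    by rewrite !mulmxA P0_diagLm diagLq_P0.
  have b2 : P0 *m (q *m h.1) *m P0 = n *m (P0 *m h.1 *m P0).
    by rewrite !mulmxA P0_diagLq diagLm_P0.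
  have b3 : P0 *m (n *m h.2) = n *m (P0 *m h.2).
    by rewrite !mulmxA P0_diagLm diagLm_P0.
  have b4 : P1 *m (n *m h.2) = n *m (P1 *m h.2) by rewrite !mulmxA nP1.
  rewrite /D /b AopE !bop_diag !DiracE ![(_, _).1]/= ![(_, _).2]/= b1 b2 b3 b4.
  rewrite pair_sub /bop; apply: pair_eq; last first.
    by rewrite mul0mx !mulmxDr -scalemxAr !mulmxA subrr.
  rewrite !mulmxDr -scalemxAr addrBDr !mulmxBl !mulmxA.
  by rewrite opprD addrACA.
by rewrite bop_mul mulmx0.
Qed.

(** Used in two directions: for the set of pairs that the Clifford algebra reaches, and for
    invariants, such as commutation or intertwining relations, that confine it. *)
Record star_closed (S : 'M[C]_4 -> 'M[C]_4 -> Prop) : Prop := StarClosed {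
  star_add X Y X' Y' : S X Y -> S X' Y' -> S (X + X') (Y + Y');
  star_scale c X Y : S X Y -> S (c *: X) (c *: Y);
  star_mul X Y X' Y' : S X Y -> S X' Y' -> S (X *m X') (Y *m Y');
  star_adj X Y : S X Y -> S (adjmx X) (adjmx Y)
}.

Lemma star_sub S X Y X' Y' :
  star_closed S -> S X Y -> S X' Y' -> S (X - X') (Y - Y').
Proof.
move=> sS SXY SXY'; rewrite -(scaleN1r X') -(scaleN1r Y').
by apply: star_add => //; apply: star_scale.
Qed.

(** An upper bound for the Clifford algebra, by induction on its generation. By [Dirac_comm],
    one-forms are built from diagonal pairs and [(Xmx alpha, Xmx beta)] by products and differences,
    so they stay in [S]. *)
Lemma Cl_bop alpha beta ups S : star_closed S ->
  (forall lam z w, S (diagLq lam z w) (diagLq lam z w)) ->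
  S (Xmx alpha) (Xmx beta) ->
  forall eta, Cl (Dirac alpha beta 0 ups) eta ->
  exists X Y N, [/\ eta = bop X Y N, S X Y & N *m P0 = P0 *m N].
Proof.
move=> sS SA SX eta; elim=> {eta}.
- move=> xi [lam [z [w [m xiE]]]]; exists (diagLq lam z w), (diagLq lam z w).
  exists (diagLm lam m); split; rewrite ?diagLm_P0 ?P0_diagLm //.
  by rewrite -AopE; apply: funext.
- move=> a b [lam [z [w [m aE]]]] [lam' [z' [w' [m' bE]]]].
  rewrite (funext aE) (funext bE) [Aop lam _ _ _]AopE Dirac_comm.
  do 3!eexists; split; first reflexivity; last by rewrite mulmx0 mul0mx.
  by apply: star_mul => //; apply: star_sub => //; apply: star_mul.
- move=> f g _ [X [Y [N [-> SXY cN]]]] _ [X' [Y' [N' [-> SXY' cN']]]].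
  exists (X + X'), (Y + Y'), (N + N'); split.
  + by apply: funext => h; apply: bop_add.
  + exact: star_add.
  + by rewrite mulmxDl mulmxDr cN cN'.
- move=> c f _ [X [Y [N [-> SXY cN]]]].
  exists (c *: X), (c *: Y), (c *: N); split.
  + by apply: funext => h; apply: bop_scale.
  + exact: star_scale.
  + by rewrite -scalemxAl cN scalemxAr.
- move=> f g _ [X [Y [N [-> SXY cN]]]] _ [X' [Y' [N' [-> SXY' cN']]]].
  exists (X *m X'), (Y *m Y'), (N *m N'); split.
  + by apply: funext => h; apply: bop_mul.
  + exact: star_mul.
  + by rewrite -mulmxA cN' !mulmxA cN.
- move=> f _ [X [Y [N [-> SXY cN]]]].
  exists (adjmx X), (adjmx Y), (adjmx N); split.
  + exact: adjop_bop.
  + exact: star_adj.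
  + by have := congr1 (@adjmx R 4 4) cN; rewrite !adjmxM adjP0.
Qed.

Lemma Cl_star_closed (D : Op R) : star_closed (fun X Y => Cl D (bop X Y 0)).
Proof.
split=> [X Y X' Y' S S'|c X Y S|X Y X' Y' S S'|X Y S].
- rewrite -[0]addr0 -(funext (bop_add X Y 0 X' Y' 0)); exact: Cl_add.
- rewrite -[0](scaler0 _ c) -(funext (bop_scale c X Y 0)); exact: Cl_scale.
- rewrite -[0](mul0mx 4 (0 : 'M[C]_4)) -(funext (bop_mul X Y 0 X' Y' 0)); exact: Cl_mul.
- rewrite -[0](adjmx0 _ 4 4) -adjop_bop; exact: Cl_adj.
Qed.

End Clifford.

(** * Unimodular numbers and proportional rows *)

Section UnimodularRows.
Variable R : realType.
Local Notation C := R[i].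

Lemma mulcJ_eq0 (x : C) : (x * conjc x == 0) = (x == 0).
Proof. by rewrite mulf_eq0 conjc_eq0 orbb. Qed.

(** The arccosine of the real part is the angle up to sign, and the sign of the imaginary part
    decides between the two. *)
Lemma expi_onto (t : C) : t * conjc t = 1 -> exists phi, t = expi phi.
Proof.
case: t => a b /eqP; rewrite eq_complex /= => /andP[/eqP ab _].
have sqs : a ^+ 2 + b ^+ 2 = 1 by rewrite -ab !expr2; ring.
have a1 : -1 <= a <= 1.
  rewrite -ler_norml -(@expr_le1 _ 2) // real_normK ?num_real //.
  by rewrite -sqs lerDl sqr_ge0.
have b2 : 1 - a ^+ 2 = b ^+ 2 by rewrite -sqs addrC addKr.
have [cos_a sin_a] : cos (acos a) = a /\ sin (acos a) = `|b|.
  by rewrite sin_acos // b2 sqrtr_sqr; split=> //; have [] := acos_def a1.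
have [b0|b0] := ger0P b.
  by exists (acos a); rewrite /expi cos_a sin_a ger0_norm.
by exists (- acos a); rewrite /expi cosN sinN cos_a sin_a ltr0_norm // opprK.
Qed.

Lemma dotcJ_eq0 (b : 'rV[C]_2) : ((b *m adjmx b) 0 0 == 0) = (b == 0).
Proof.
rewrite mxE big_ord_recl big_ord1 !mxE paddr_eq0 ?mulcJ_ge0 // !mulcJ_eq0.
apply/andP/eqP => [[/eqP b0 /eqP b1]|->]; last by rewrite !mxE.
apply/rowP => j; rewrite mxE; have [j0|j0] := eqVneq j ord0.
  by rewrite j0.
by rewrite -[RHS]b1; congr (b _ _); apply/val_inj; case: j j0 => [[|[]]].
Qed.

(* Equality case of Cauchy-Schwarz, via Lagrange's identity
   [|a b^*|^2 = |a|^2 |b|^2 - |a0 b1 - a1 b0|^2]. *)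
Lemma parallel_expi (a b : 'rV[C]_2) : b != 0 ->
  (a *m adjmx a) 0 0 = (b *m adjmx b) 0 0 ->
  a 0 0 * b 0 1 = a 0 1 * b 0 0 -> exists phi, a = expi phi *: b.
Proof.
rewrite -dotcJ_eq0 => b0 ab det0.
have o1 : lift ord0 ord0 = 1 :> 'I_2 by apply/val_inj.
move: ab b0; rewrite !mxE !big_ord_recl !big_ord0 !mxE !addr0 !o1.
set r := b 0 0 * _ + _ => ab b0.
have det0' : conjc (a 0 0) * conjc (b 0 1) = conjc (a 0 1) * conjc (b 0 0).
  by rewrite -!rmorphM det0.
(* With [s] the Hermitian product of the rows and [r] their common squared norm, the vanishing
   determinant gives [s b = r a]; hence [s / r] is the wanted phase. *)
pose s := a 0 0 * conjc (b 0 0) + a 0 1 * conjc (b 0 1).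
have sb0 : s * b 0 0 = r * a 0 0.
  have -> : s * b 0 0 = a 0 0 * (b 0 0 * conjc (b 0 0))
                        + (a 0 1 * b 0 0) * conjc (b 0 1) by rewrite /s; ring.
  by rewrite -det0 /r; ring.
have sb1 : s * b 0 1 = r * a 0 1.
  have -> : s * b 0 1 = (a 0 0 * b 0 1) * conjc (b 0 0)
                        + a 0 1 * (b 0 1 * conjc (b 0 1)) by rewrite /s; ring.
  by rewrite det0 /r; ring.
have rJ : conjc r = r.
  by rewrite /r rmorphD !rmorphM /= !conjcK mulrC [X in _ + X]mulrC.
have : (s / r) * conjc (s / r) = 1.
  have sJ : s * conjc s = r * r.
    have -> : s * conjc s = conjc (a 0 0) * (s * b 0 0)
                            + conjc (a 0 1) * (s * b 0 1).
      by rewrite {2}/s rmorphD !rmorphM /= !conjcK; ring.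
    by rewrite sb0 sb1 -{3}ab; ring.
  rewrite rmorphM /= conjc_inv rJ mulrACA sJ -invfM divff //.
  by rewrite mulf_neq0.
case/expi_onto => phi phiE; exists phi; rewrite -phiE.
have o j : j = 0 \/ j = 1 :> 'I_2.
  by case: j => [[|[]]] // ?; [left|right]; apply/val_inj.
by apply/rowP => j; rewrite mxE; case: (o j) => ->;
   rewrite mulrAC ?sb0 ?sb1 mulrC mulKf.
Qed.

End UnimodularRows.

(** * Generating all pairs of matrices from the one-forms *)

Section Generation.
Variable R : realType.
Local Notation C := R[i].
Implicit Types (X Y : 'M[C]_4) (x : 'M[C]_2).

(** A nonzero row has a right inverse column [B], and [q] is [B] times row [i] of [x]. *)
Lemma row_mulmx_surj n m (A : 'M[C]_(n, m)) i (x : 'M[C]_n) :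
  row i A != 0 -> exists q, delta_mx i i *m A *m q = delta_mx i i *m x.
Proof.
move=> Ai; have /row_freeP[B AB] : row_free (row i A).
  by rewrite /row_free rank_rV Ai.
have d_row p (M : 'M_(n, p)) : delta_mx i i *m M = delta_mx i (0 : 'I_1) *m row i M.
  by rewrite rowE mulmxA mul_delta_mx.
by exists (B *m row i x); rewrite !d_row -mulmxA [row i A *m _]mulmxA AB mul1mx.
Qed.

Definition ur x : 'M[C]_4 := blk 0 x 0 0.

Variables (S : 'M[C]_4 -> 'M[C]_4 -> Prop) (alpha beta : 'M[C]_2).
Hypothesis sS : star_closed S.
Hypothesis S_ur : forall i q,
  S (ur (delta_mx i i *m alpha *m q)) (ur (delta_mx i i *m beta *m q)).

Let blkE0 := (mulmx0, mul0mx, addr0, add0r, adjmx0, blk0).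

(** The matrices [X] with [S X 0] absorb products with first components of [S]. From the corner
    unit, one-forms give row [i] of the upper right block; products with adjoints give the lower
    right identity; this yields every upper right row, and then all four blocks. *)
Lemma star_first i : (forall j, row j alpha != 0) ->
  S (blk (delta_mx i i) 0 0 0) 0 -> forall X, S X 0.
Proof.
move=> alpha0 Si.
have mulr0 X Y Z : S X 0 -> S Y Z -> S (X *m Y) 0.
  by move=> SX SY; rewrite -(mul0mx 4 Z); apply: star_mul.
have mul0r X Y Z : S X 0 -> S Y Z -> S (Y *m X) 0.
  by move=> SX SY; rewrite -(mulmx0 4 Z); apply: star_mul.
have add0 X Y : S X 0 -> S Y 0 -> S (X + Y) 0.
  by move=> SX SY; rewrite -[0]addr0; apply: star_add.
have adj0 X : S X 0 -> S (adjmx X) 0.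
  by move=> SX; rewrite -[0](adjmx0 R 4 4); apply: star_adj.
have ur_i x : S (ur (delta_mx i i *m x)) 0.
  have [q <-] := row_mulmx_surj x (alpha0 i).
  have := mulr0 _ _ _ Si (S_ur i q).
  by rewrite blkM !blkE0 !mulmxA mul_delta_mx.
have dr_k k : S (blk 0 0 0 (delta_mx k k)) 0.
  have := ur_i (delta_mx i k); rewrite mul_delta_mx => Sik.
  have := mulr0 _ _ _ (adj0 _ Sik) Sik.
  by rewrite adjmx_blk blkM adjmx_delta mul_delta_mx !blkE0.
have dr1 : S (blk 0 0 0 1%:M) 0.
  have := add0 _ _ (dr_k ord0) (dr_k (lift ord0 ord0)).
  by rewrite blkD mx1_sum_delta big_ord_recl big_ord1 !blkE0.
have ur_all x : S (ur x) 0.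
  have ur_k k : S (ur (delta_mx k k *m x)) 0.
    have [q <-] := row_mulmx_surj x (alpha0 k).
    by have := mul0r _ _ _ dr1 (S_ur k q); rewrite blkM !mulmx1 !blkE0.
  have := add0 _ _ (ur_k ord0) (ur_k (lift ord0 ord0)).
  rewrite blkD -mulmxDl !blkE0 -[X in ur X]mul1mx mx1_sum_delta.
  by rewrite big_ord_recl big_ord1.
have dl_all x : S (blk 0 0 x 0) 0.
  by have := adj0 _ (ur_all (adjmx x)); rewrite adjmx_blk adjmxK !blkE0.
have ul_all x : S (blk x 0 0 0) 0.
  by have := mulr0 _ _ _ (ur_all x) (dl_all 1%:M); rewrite blkM !mulmx1 !blkE0.
have dr_all x : S (blk 0 0 0 x) 0.
  by have := mulr0 _ _ _ (dl_all x) (ur_all 1%:M); rewrite blkM !mulmx1 !blkE0.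
move=> X; have [a [b [c [d ->]]]] := blkE X.
have := add0 _ _ (add0 _ _ (ul_all a) (ur_all b))
                 (add0 _ _ (dl_all c) (dr_all d)).
by rewrite !blkD !blkE0.
Qed.

Lemma ur_adj x : ur x *m adjmx (ur x) = blk (x *m adjmx x) 0 0 0.
Proof. by rewrite adjmx_blk blkM !blkE0. Qed.

(** Once the first component is free, it can be subtracted from a one-form whose second component is
    [ur (delta_mx i i)]; multiplying the result by its adjoint gives the corner unit. *)
Lemma star_second i : row i beta != 0 ->
  (forall X, S X 0) -> S 0 (blk (delta_mx i i) 0 0 0).
Proof.
move=> betai SX; have [q Eq] := row_mulmx_surj 1%:M betai.
have := star_sub sS (S_ur i q) (SX (ur (delta_mx i i *m alpha *m q))).
rewrite Eq mulmx1 subrr subr0 => Su.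
have := star_mul sS Su (star_adj sS Su).
by rewrite ur_adj adjmx_delta mul_delta_mx mul0mx.
Qed.

(* If row [i] of [alpha] is not a unimodular multiple of row [i] of [beta],
   then either some [q] kills one row but not the other, or the rows have
   different norms and [T^2 - |row i alpha|^2 T], with [T] the square of the
   one-form [S_ur i 1], has exactly one vanishing component. *)
Lemma star_split i : row i alpha != 0 -> row i beta != 0 ->
  ~ (exists phi, row i alpha = expi phi *: row i beta) ->
  S (blk (delta_mx i i) 0 0 0) 0 \/ S 0 (blk (delta_mx i i) 0 0 0).
Proof.
set a := row i alpha; set b := row i beta => a0 b0 nphase.
(* Factoring through the column [e] reduces products of one-forms and their adjoints to scalar
   products of the rows [a] and [b]. *)
pose e : 'cV[C]_2 := delta_mx i 0.
have rowsE (g q : 'M[C]_2) : delta_mx i i *m g *m q = e *m (row i g *m q).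
  by rewrite rowE !mulmxA mul_delta_mx.
have eE (t : 'M[C]_1) : e *m t *m adjmx e = t 0 0 *: delta_mx i i.
  rewrite [t]mx11_scalar mul_mx_scalar -scalemxAl adjmx_delta mul_delta_mx.
  by rewrite mxE eqxx.
have blk_ul x c : blk (c *: x) 0 0 0 = c *: blk x 0 0 0.
  by rewrite blkZ !scaler0.
have sq q := star_mul sS (S_ur i q) (star_adj sS (S_ur i q)).
pose s := (a *m adjmx a) 0 0; pose r := (b *m adjmx b) 0 0.
have r0 : r != 0 by rewrite dotcJ_eq0.
have [sr|sr] := eqVneq s r; last first.
  right; have T : S (s *: blk (delta_mx i i) 0 0 0) (r *: blk (delta_mx i i) 0 0 0).
    have := sq 1%:M; rewrite !ur_adj !rowsE !mulmx1 !adjmxM.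
    by rewrite !mulmxA -(mulmxA e a) -(mulmxA e b) !eE !blk_ul.
  have := star_sub sS (star_mul sS T T) (star_scale sS s T).
  rewrite -!scalemxAl -!scalemxAr blkM mul_delta_mx !blkE0 subrr.
  rewrite !scalerA -scalerBl -mulrBl => T'.
  have := star_scale sS ((r - s) * r)^-1 T'; rewrite scaler0 scalerA mulVf ?scale1r //.
  by rewrite mulf_neq0 // subr_eq0 eq_sym.
left; pose d := a 0 0 * b 0 1 - a 0 1 * b 0 0.
have [d0|d0] := eqVneq d 0.
  by case: nphase; apply: parallel_expi => //; apply/eqP; rewrite -subr_eq0 -/d d0.
(* The first column of [q] is chosen so that [g *m q] has the determinant of [g] and [b] as its
   first entry: it kills [b] and sends [a] to the nonzero [d]. *)
pose q : 'M[C]_2 := \matrix_(k, l)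
  if l == 0 then (if k == 0 then b 0 1 else - b 0 0) else 0.
have qE (g : 'rV[C]_2) :
    g *m q = (g 0 0 * b 0 1 - g 0 1 * b 0 0) *: delta_mx 0 0.
  apply/rowP => l; rewrite mxE big_ord_recl big_ord1 !mxE.
  have -> : lift ord0 ord0 = 1 :> 'I_2 by apply/val_inj.
  by case: (l == 0); rewrite /= ?mulr1 ?mulr0 ?addr0 // mulrN.
have := sq q; rewrite !ur_adj !rowsE !qE -/a -/b -/d.
rewrite [b 0 0 * _]mulrC subrr scale0r !blkE0 -scalemxAr adjmxZ.
rewrite -scalemxAl -scalemxAr scalerA mul_delta_mx adjmx_delta mul_delta_mx.
rewrite blk_ul => Sd; have := star_scale sS (d * conjc d)^-1 Sd.
by rewrite scaler0 scalerA mulVf ?scale1r // mulcJ_eq0.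
Qed.

End Generation.

(** One split row suffices: [star_first] fills the isolated component, [star_second] passes a corner
    unit to the other, and [star_first] fills that one too. Exchanging [alpha] and [beta] treats
    both outcomes of [star_split] alike. *)
Lemma star_full (R : realType) (S : 'M[R[i]]_4 -> 'M[R[i]]_4 -> Prop)
    (alpha beta : 'M[R[i]]_2) i : star_closed S ->
  (forall i q, S (ur (delta_mx i i *m alpha *m q)) (ur (delta_mx i i *m beta *m q))) ->
  (forall i, row i alpha != 0) -> (forall i, row i beta != 0) ->
  ~ (exists phi, row i alpha = expi phi *: row i beta) ->
  forall X Y, S X Y.
Proof.
move=> sS S_ur a0 b0 nphase X Y.
have sS' : star_closed (fun X Y => S Y X).
  by case: sS => sD sZ sM sA; split=> *; [apply: sD|apply: sZ|apply: sM|apply: sA].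
have S_ur' i q := S_ur i q : (fun X Y => S Y X) _ _.
suff [SX SY] : (forall X, S X 0) /\ (forall Y, S 0 Y).
  by rewrite -[X]addr0 -[Y]add0r; apply: star_add.
have [Si|Si] := star_split sS S_ur (a0 i) (b0 i) nphase.
  have SX := star_first sS S_ur a0 Si; split=> //.
  exact: (star_first sS' S_ur' b0 (star_second sS S_ur (b0 i) SX)).
have SY := star_first sS' S_ur' b0 Si; split=> //.
exact: (star_first sS S_ur a0 (star_second sS' S_ur' (a0 i) SY)).
Qed.

(** * Complex spans of quaternions and explicit 2 by 2 matrices *)

Section HodgeProperty.
Variable R : realType.
Local Notation C := R[i].
Local Notation P0 := (P0 R).
Local Notation P1 := (P1 R).
Implicit Types (X Y N : 'M[C]_4) (h : H R).

Let blkE0 := (mulmx0, mul0mx, addr0, add0r, adjmx0, blk0).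

(** Complexified quaternions are all of M_2(C). The solution is [z1 = (a + conjc d) / 2] and
    [z2 = (a - conjc d) / (2 'i)]. *)
Lemma quaternion_span (a d : C) : exists z1 z2,
  a = z1 + 'i%C * z2 /\ d = conjc z1 + 'i%C * conjc z2.
Proof.
case: a d => [a1 a2] [d1 d2].
exists (((a1 + d1) / 2) +i* ((a2 - d2) / 2))%C.
exists (((a2 + d2) / 2) +i* ((d1 - a1) / 2))%C.
by split; apply/eqP; rewrite eq_complex /=; apply/andP; split; apply/eqP; field.
Qed.

Lemma mx2_eta (q : 'M[C]_2) : q = mx2 (q 0 0) (q 0 1) (q 1 0) (q 1 1).
Proof.
apply/matrixP => i j; rewrite mxE.
by case: i => [[|[]]] //= ?; case: j => [[|[]]] //= ?; congr (q _ _); apply/val_inj.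
Qed.

Lemma mx2D (a b c d a' b' c' d' : C) :
  mx2 a b c d + mx2 a' b' c' d' = mx2 (a + a') (b + b') (c + c') (d + d').
Proof. by apply/matrixP => i j; rewrite !mxE; do 2?case: ifP. Qed.

Lemma mx2Z (x a b c d : C) :
  x *: mx2 a b c d = mx2 (x * a) (x * b) (x * c) (x * d).
Proof. by apply/matrixP => i j; rewrite !mxE; do 2?case: ifP. Qed.

Lemma mx2_0 : mx2 0 0 0 0 = 0 :> 'M[C]_2.
Proof. by apply/matrixP => i j; rewrite !mxE; do 2?case: ifP. Qed.

Lemma mx2_1 : mx2 1 0 0 1 = 1%:M :> 'M[C]_2.
Proof.
apply/matrixP => i j; rewrite !mxE.
by case: i => [[|[]]] //= ?; case: j => [[|[]]].
Qed.

Lemma mx2_diagM (a b c d : C) :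
  mx2 a 0 0 b *m mx2 c 0 0 d = mx2 (a * c) 0 0 (b * d).
Proof.
apply/matrixP => i j; rewrite !mxE big_ord_recl big_ord1 !mxE.
by case: i => [[|[]]] //= ?; case: j => [[|[]]] //= ?;
   rewrite ?(mulr0, mul0r, addr0, add0r).
Qed.

Lemma adjmx_mx2 (a d : C) : adjmx (mx2 a 0 0 d) = mx2 (conjc a) 0 0 (conjc d).
Proof.
apply/matrixP => i j; rewrite !mxE.
by case: i => [[|[]]] //= ?; case: j => [[|[]]] //= ?; rewrite oppr0.
Qed.

Lemma delta_mx2 (i : 'I_2) :
  delta_mx i i = mx2 (i == 0)%:R 0 0 (i == 1)%:R :> 'M[C]_2.
Proof.
apply/matrixP => j k; rewrite !mxE.
by case: i => [[|[]]] //= ?; case: j => [[|[]]] //= ?; case: k => [[|[]]].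
Qed.

Lemma diagLq_blk (lam z w : C) :
  diagLq lam z w = blk (mx2 lam 0 0 (conjc lam)) 0 0
                       (mx2 z w (- conjc w) (conjc z)).
Proof. by []. Qed.

Lemma diagLm0 : diagLm 0 0 = 0 :> 'M[C]_4.
Proof. by rewrite /diagLm raddf0 (@block_mx_const _ 1 3 1 3). Qed.

(** * Sufficiency: the Clifford algebra is as large as possible *)

Section Good.
Variables (alpha beta : 'M[C]_2) (ups : C).
Let D := Dirac alpha beta 0 ups.
Let S X Y := Cl D (bop X Y 0).

Lemma inA_Aop (lam z w : C) m : inA (Aop lam z w m).
Proof. by exists lam, z, w, m. Qed.

Lemma Cl_quaternion (q : 'M[C]_2) : S (blk 0 0 0 q) (blk 0 0 0 q).
Proof.
have sS := Cl_star_closed D.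
have SQ z w (Q := blk 0 0 0 (mx2 z w (- conjc w) (conjc z))) : S Q Q.
  by have := Cl_A D (inA_Aop 0 z w 0); rewrite AopE diagLm0 diagLq_blk rmorph0 mx2_0.
have [z1 [z2 [z00 z11]]] := quaternion_span (q 0 0) (q 1 1).
(* The sign matches the lower left entry [- conjc w] of a quaternion. *)
have [w1 [w2 [w01 w10]]] := quaternion_span (q 0 1) (- q 1 0).
have -> : q = mx2 z1 w1 (- conjc w1) (conjc z1)
              + 'i%C *: mx2 z2 w2 (- conjc w2) (conjc z2).
  rewrite mx2Z mx2D -z00 -z11 -w01 [LHS]mx2_eta mulrN -opprD.
  by rewrite -[_ + 'i%C * _]w10 opprK.
have := star_add sS (SQ z1 w1) (star_scale sS 'i%C (SQ z2 w2)).
by rewrite blkZ blkD !scaler0 !addr0.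
Qed.

(** Commuting [D] with the unit quaternion and multiplying on the left by an element with only [lam]
    leaves the upper right block. Complex combinations over [lam] isolate row [i], and
    [Cl_quaternion] supplies [q]. *)
Lemma Cl_one_form i (q : 'M[C]_2) :
  S (ur (delta_mx i i *m alpha *m q)) (ur (delta_mx i i *m beta *m q)).
Proof.
have sS := Cl_star_closed D.
have comm_q (g : 'M[C]_2) : Xmx g *m diagLq 0 1 0 - diagLq 0 1 0 *m Xmx g
    = blk 0 g (- adjmx g) 0.
  rewrite diagLq_blk rmorph0 mx2_0 oppr0 rmorph1 mx2_1 -[Xmx g]/(blk _ _ _ _).
  by rewrite !blkM blkN blkD mulmx1 mul1mx !blkE0 !oppr0 !addr0.
have S_lam lam (L := mx2 lam 0 0 (conjc lam)) : S (ur (L *m alpha)) (ur (L *m beta)).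
  have := Cl_comm D (inA_Aop lam 0 0 0) (inA_Aop 0 1 0 0).
  rewrite [Aop lam _ _ _]AopE Dirac_comm !comm_q diagLq_blk !conjc0 oppr0 mx2_0.
  by rewrite !blkM !blkE0.
have S_i : S (ur (delta_mx i i *m alpha)) (ur (delta_mx i i *m beta)).
  (* Here [c * 'i%C] is 1/2 for row 0 and -1/2 for row 1, so adding half the identity leaves
     e_ii. *)
  pose c : C := ((i == 1)%:R - (i == 0)%:R) / 2 * 'i%C.
  have -> : delta_mx i i = 2^-1 *: mx2 1 0 0 (conjc 1)
                           + c *: mx2 'i%C 0 0 (conjc 'i%C).
    rewrite delta_mx2 !mx2Z mx2D !mulr0 addr0 rmorph1 /c.
    have i2 : 'i%C * 'i%C = -1 :> C by rewrite -expr2 sqr_i.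
    have iJ : 'i%C^*%C = - 'i%C :> C by apply/eqP; rewrite eq_complex /= oppr0 !eqxx.
    rewrite iJ mulrN -!mulrA i2 !mulr1 mulrN1.
    by clear c; case: i => [[|[]]] //= ?; congr mx2; field.
  rewrite !mulmxDl -!scalemxAl.
  have := star_add sS (star_scale sS 2^-1 (S_lam 1)) (star_scale sS c (S_lam 'i%C)).
  by rewrite !blkZ !blkD !scaler0 !addr0.
have := star_mul sS S_i (Cl_quaternion q).
by rewrite !blkM !blkE0.
Qed.

Lemma Cl_full : (forall i, row i alpha != 0) -> (forall i, row i beta != 0) ->
  ~ (exists phi psi : R, alpha = mx2 (expi phi) 0 0 (expi psi) *m beta) ->
  forall X Y N, N *m P0 = P0 *m N -> Cl D (bop X Y N).
Proof.
move=> a0 b0 nphase.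
have SXY : forall X Y, S X Y.
  have sS := Cl_star_closed D.
  have full i := @star_full _ S alpha beta i sS Cl_one_form a0 b0.
  (* If either row is not a unimodular multiple, [star_full] applies to it; if both are, [alpha] is
     the excluded multiple of [beta]. *)
  have [p0|/full //] := pselect (exists phi, row 0 alpha = expi phi *: row 0 beta).
  have [p1|/full //] := pselect (exists phi, row 1 alpha = expi phi *: row 1 beta).
  case: p0 p1 nphase => [phi p0] [psi p1] []; exists phi, psi.
  apply/matrixP => i j; rewrite !mxE big_ord_recl big_ord1 !mxE.
  have -> : lift ord0 ord0 = 1 :> 'I_2 by apply/val_inj.
  case: i => [[|[]]] //= i_lt; rewrite !mul0r ?addr0 ?add0r.
    have -> : Ordinal i_lt = 0 by apply/val_inj.
    by have /rowP/(_ j) := p0; rewrite !mxE.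
  have -> : Ordinal i_lt = 1 by apply/val_inj.
  by have /rowP/(_ j) := p1; rewrite !mxE.
move=> X Y N /diagLm_comm[lam [m ->]].
(* An element of [A] supplies [N], and its first two entries are corrected to [X] and [Y]. *)
have := Cl_add (Cl_A D (inA_Aop lam 0 0 m)) (SXY (X - diagLq lam 0 0) (Y - diagLq lam 0 0)).
by rewrite AopE (funext (bop_add _ _ _ _ _ _)) ![diagLq _ _ _ + _]addrC !subrK addr0.
Qed.

End Good.

(** For one inclusion, [commutant_bop] applies since the algebra contains every admissible [bop];
    for the other, the shape of its elements makes them commute with opposites. *)
Lemma hodge_sufficient (alpha beta : 'M[C]_2) (ups : C) :
  (forall i, row i alpha != 0) -> (forall i, row i beta != 0) ->
  ~ (exists phi psi : R, alpha = mx2 (expi phi) 0 0 (expi psi) *m beta) ->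
  Hodge (Dirac alpha beta 0 ups).
Proof.
move=> a0 b0 nphase xi; have full := Cl_full ups a0 b0 nphase.
split=> [[lxi cxi]|[eta [Ceta xiE]]].
  have [X Y N cN|X [Y [N [cN xiE]]]] := commutant_bop lxi.
    by apply: cxi; apply: full.
  by exists (bop X Y N); split=> //; apply: full.
rewrite (funext xiE).
have sT : star_closed (fun _ _ : 'M[C]_4 => True) by [].
have ClE := @Cl_bop _ alpha beta ups _ sT (fun _ _ _ => I) I.
have [X [Y [N [-> _ cN]]]] := ClE _ Ceta.
split; first by rewrite (funext (opp_bop X Y N)); apply: linop_bop_opp.
move=> _ /ClE[X' [Y' [N' [-> _ cN']]]] h.
exact: bop_opp_comm.
Qed.

(** * Necessity: extra elements of the commutant in the exceptional cases *)

Section Necessary.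
Variables (alpha beta : 'M[C]_2) (ups : C).

(** The operator [(v, w) |-> (T v y, 0)] commutes with the Clifford algebra. The Hodge property puts
    it in the opposite algebra, which acts on the first summand by right multiplications. *)
Lemma hodge_commutant (S : 'M[C]_4 -> 'M[C]_4 -> Prop) (T y : 'M[C]_4) :
  Hodge (Dirac alpha beta 0 ups) -> star_closed S ->
  (forall lam z w, S (diagLq lam z w) (diagLq lam z w)) ->
  S (Xmx alpha) (Xmx beta) ->
  (forall X Y v, S X Y -> T *m (X *m v *m P0 + Y *m v *m P1) *m y =
     X *m (T *m v *m y) *m P0 + Y *m (T *m v *m y) *m P1) ->
  exists N, N *m P0 = P0 *m N /\ forall v, T *m v *m y = v *m N.
Proof.
move=> hodge sS SA SX cT; have ClE := Cl_bop sS SA SX.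
pose xi : Op R := fun h => (T *m h.1 *m y, 0).
have /(hodge xi)[eta [/ClE[X [Y [N [-> _ cN]]]] xiE]] :
    linop xi /\ forall eta, Cl (Dirac alpha beta 0 ups) eta ->
                forall h, xi (eta h) = eta (xi h).
  split=> [c x z|eta /ClE[X [Y [N [-> SXY _]]]] h].
    rewrite /xi mulmxDr mulmxDl -scalemxAr -scalemxAl.
    by rewrite [RHS]surjective_pairing /= scaler0 addr0.
  by rewrite /xi /bop /= mulmx0 cT.
exists N; split=> // v; have := xiE (v, 0); rewrite opp_bop /xi /=.
by case.
Qed.

(** Testing on [delta_mx j k] shows that every row of [N] vanishes; testing on [delta_mx i k] then
    shows the same for [y]. *)
Lemma delta_intertwine (n : nat) (i j : 'I_n) (y N : 'M[C]_n) : j != i ->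
  (forall v, delta_mx i i *m v *m y = v *m N) -> y = 0.
Proof.
move=> ji iN; have N0 : N = 0.
  apply/matrixP => k l; have /matrixP/(_ j l) := iN (delta_mx j k).
  by rewrite -mulmxA !delta_mulE eqxx (negbTE ji) mulr1n mulr0n mxE => <-.
apply/matrixP => k l; have /matrixP/(_ i l) := iN (delta_mx i k).
by rewrite mul_delta_mx delta_mulE eqxx N0 mulmx0 mulr1n !mxE.
Qed.

Lemma blk_delta_intertwine (i : 'I_2) (y N : 'M[C]_4) :
  (forall v, blk (delta_mx i i) 0 0 0 *m v *m y = v *m N) -> y = 0.
Proof.
by rewrite blk_delta; apply: (@delta_intertwine 4 _ (rshift 2 ord0)); case: i => [[|[]]].
Qed.

Lemma P0_neq0 : P0 <> 0.
Proof.
by rewrite P0E => /matrixP/(_ k0 k0); rewrite !mxE /= => /eqP; rewrite oner_eq0.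
Qed.

Lemma P1_neq0 : P1 <> 0.
Proof.
rewrite P1E P0E => /matrixP/(_ (lift k0 ord0) (lift k0 ord0)).
by rewrite !mxE /= subr0 => /eqP; rewrite oner_eq0.
Qed.

Lemma diagLq_delta_comm (i : 'I_2) lam z w (E := blk (delta_mx i i) 0 0 0) :
  diagLq lam z w *m E = E *m diagLq lam z w :> 'M[C]_4.
Proof.
rewrite /E diagLq_blk delta_mx2 !blkM !blkE0 !mx2_diagM.
by rewrite mulrC [_ * (i == 1)%:R]mulrC.
Qed.

Lemma Xmx_delta_comm (i : 'I_2) (g : 'M[C]_2) (E := blk (delta_mx i i) 0 0 0) :
  row i g = 0 -> Xmx g *m E = E *m Xmx g.
Proof.
move=> gi0; have dg : delta_mx i i *m g = 0.
  by rewrite -(mul_delta_mx (0 : 'I_1)) -mulmxA -rowE gi0 mulmx0.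
have gd : adjmx g *m delta_mx i i = 0.
  by rewrite -[LHS]adjmxK adjmxM adjmxK adjmx_delta dg adjmx0.
by rewrite /E -[Xmx g]/(blk _ _ _ _) !blkM dg gd !blkE0.
Qed.

Lemma star_closed_comm (E : 'M[C]_4) : adjmx E = E ->
  (star_closed (fun X Y => X *m E = E *m X)) *
  (star_closed (fun X Y => Y *m E = E *m Y)).
Proof.
have cD X Y : X *m E = E *m X -> Y *m E = E *m Y -> (X + Y) *m E = E *m (X + Y).
  by move=> cX cY; rewrite mulmxDl mulmxDr cX cY.
have cZ c X : X *m E = E *m X -> (c *: X) *m E = E *m (c *: X).
  by move=> cX; rewrite -scalemxAl cX scalemxAr.
have cM X Y : X *m E = E *m X -> Y *m E = E *m Y -> (X *m Y) *m E = E *m (X *m Y).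
  by move=> cX cY; rewrite -mulmxA cY !mulmxA cX.
move=> adjE; have cA X : X *m E = E *m X -> adjmx X *m E = E *m adjmx X.
  by move/(congr1 (@adjmx R 4 4)); rewrite !adjmxM adjE.
by split; split=> *; [exact: cD|exact: cZ|exact: cM|exact: cA
                     |exact: cD|exact: cZ|exact: cM|exact: cA].
Qed.

(** If row [i] vanishes, [E] commutes with all first components, so [v |-> E v P0] extends by zero
    to an element of the commutant, yet it is not a right multiplication. *)
Lemma hodge_row_alpha i : Hodge (Dirac alpha beta 0 ups) -> row i alpha != 0.
Proof.
move=> hodge; apply/eqP => ai0; pose E : 'M[C]_4 := blk (delta_mx i i) 0 0 0.
have adjE : adjmx E = E by rewrite /E adjmx_blk adjmx_delta !adjmx0.
have [//|||N [_ /blk_delta_intertwine]] :=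
    @hodge_commutant _ E P0 hodge (star_closed_comm adjE).1.
- exact: diagLq_delta_comm.
- exact: Xmx_delta_comm.
- move=> X Y v cX; rewrite mulmxDr mulmxDl -!mulmxA P0P0 P1P0 P0P1 !mulmx0 !addr0.
  by rewrite !mulmxA cX.
exact: P0_neq0.
Qed.

Lemma hodge_row_beta i : Hodge (Dirac alpha beta 0 ups) -> row i beta != 0.
Proof.
move=> hodge; apply/eqP => bi0; pose E : 'M[C]_4 := blk (delta_mx i i) 0 0 0.
have adjE : adjmx E = E by rewrite /E adjmx_blk adjmx_delta !adjmx0.
have [//|||N [_ /blk_delta_intertwine]] :=
    @hodge_commutant _ E P1 hodge (star_closed_comm adjE).2.
- exact: diagLq_delta_comm.
- exact: Xmx_delta_comm.
- move=> X Y v cY; rewrite mulmxDr mulmxDl -!mulmxA P1P1 P1P0 P0P1 !mulmx0 !add0r.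
  by rewrite !mulmxA cY.
exact: P1_neq0.
Qed.

Lemma expi_conj (phi : R) : expi phi * conjc (expi phi) = 1.
Proof.
by apply/eqP; rewrite eq_complex /=; apply/andP; split; apply/eqP;
   [rewrite mulrN opprK -!expr2 cos2Dsin2|ring].
Qed.

(** The block diagonal unitary [U] of [u] and 1 intertwines the components, [X U = U Y], so
    [adjmx U] can carry column 0, where [X] acts, to a column where [Y] acts. *)
Lemma hodge_phases : Hodge (Dirac alpha beta 0 ups) ->
  ~ (exists phi psi : R, alpha = mx2 (expi phi) 0 0 (expi psi) *m beta).
Proof.
move=> hodge [phi [psi]]; set u := mx2 _ _ _ _ => alphaE.
have uu : u *m adjmx u = 1%:M.
  by rewrite adjmx_mx2 mx2_diagM !expi_conj mx2_1.
have uu' : adjmx u *m u = 1%:M by apply: mulmx1C.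
pose U : 'M[C]_4 := blk u 0 0 1%:M.
have UU : U *m adjmx U = 1%:M.
  rewrite adjmx_blk blkM adjmx1 uu !mulmx1 !blkE0.
  exact: esym (@scalar_mx_block _ 2 2 1).
have UU' : adjmx U *m U = 1%:M by apply: mulmx1C.
have swapU X Y : X *m U = U *m Y -> adjmx U *m X = Y *m adjmx U.
  move=> XU; rewrite -[X in adjmx U *m X]mulmx1 -UU (mulmxA X) XU !mulmxA.
  by rewrite UU' mul1mx.
(* Right multiplication by [y] moves column 0 to column 1, from the range of [P0] to that of
   [P1]. *)
pose y : 'M[C]_4 := delta_mx k0 (lift k0 ord0).
have P0y : P0 *m y = y by rewrite P0E mul_delta_mx.
have P1y : P1 *m y = 0 by rewrite P1E mulmxBl P0y mul1mx subrr.
have yP0 : y *m P0 = 0 by rewrite P0E mul_delta_mx_cond.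
have yP1 : y *m P1 = y by rewrite P1E mulmxBr yP0 mulmx1 subr0.
have [||||N [cN UyN]] :=
    @hodge_commutant (fun X Y => X *m U = U *m Y) (adjmx U) y hodge.
- split=> [X Y X' Y' XU XU'|c X Y XU|X Y X' Y' XU XU'|X Y XU].
  + by rewrite mulmxDl mulmxDr XU XU'.
  + by rewrite -scalemxAl XU scalemxAr.
  + by rewrite -mulmxA XU' !mulmxA XU.
  + have := congr1 (@adjmx R 4 4) (swapU _ _ XU).
    by rewrite !adjmxM adjmxK.
- move=> lam z w; rewrite diagLq_blk !blkM !blkE0 mulmx1 mul1mx !mx2_diagM.
  by rewrite mulrC [conjc lam * _]mulrC.
- rewrite -[Xmx alpha]/(blk _ _ _ _) -[Xmx beta]/(blk _ _ _ _) !blkM !blkE0.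
  by rewrite mulmx1 mul1mx alphaE adjmxM -mulmxA uu' mulmx1.
- move=> X Y v XU; rewrite mulmxDr mulmxDl -!mulmxA P0y P1y yP0 yP1 !mulmx0.
  by rewrite addr0 add0r !mulmxA (swapU _ _ XU).
(* Taking [v = 1] gives [N = adjmx U *m y], so [N P0], which equals [P0 N], is zero; taking [v = P0]
   then forces [y = 0]. *)
have N0 : P0 *m N = 0.
  by have := UyN P0; have := UyN 1%:M; rewrite mulmx1 mul1mx -cN => <- _;
     rewrite -mulmxA yP0 mulmx0.
have : y = 0.
  by have := UyN P0; rewrite N0 -mulmxA P0y => Uy0; rewrite -[y]mul1mx -UU -mulmxA Uy0 mulmx0.
move/matrixP/(_ k0 (lift k0 ord0)); rewrite !mxE /= => /eqP.
by rewrite oner_eq0.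
Qed.

End Necessary.
End HodgeProperty.

Theorem theorem15 (R : realType) (alpha beta : 'M[R[i]]_2)
  (d12 d13 d14 d21 d22 d23 d24 ups : R[i]) :
  d12 = 0 -> d13 = 0 -> d14 = 0 -> d21 = 0 -> d22 = 0 -> d23 = 0 -> d24 = 0 ->
  Hodge (Dirac alpha beta (Ymx d12 d13 d14 d21 d22 d23 d24) ups) <->
  (((forall i : 'I_2, row i alpha != 0) /\ (forall i : 'I_2, row i beta != 0)) /\
   ~ (exists phi psi : R,
        alpha = mx2 (expi phi) 0 0 (expi psi) *m beta)).
Proof.
move=> -> -> -> -> -> -> ->; rewrite Ymx0; split=> [hodge|[[a0 b0] nphase]].
  split; last exact: hodge_phases hodge.
  by split=> i; [apply: hodge_row_alpha hodge|apply: hodge_row_beta hodge].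
exact: hodge_sufficient.
Qed.
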